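(* Let $n\ge 1$ and let $G$ be a vertex-transitive simple graph with node set $[n]$. Then $$\vartheta^+(G)=\hat{\vartheta}(G).$$ In particular, if $G$ is vertex-transitive and perfect, then $\omega(G)=\hat{\vartheta}(\overline{G})=\chi(G)$.
   Context: $[n]=\{1,\dots,n\}$; $\overline{G}$ is the complement graph of $G$, and $\mathbf{A}_{H}$ denotes the adjacency matrix of a graph $H$. $\mathbf{e}$ is the all-ones vector in $\mathbb{R}^n$, $\langle\cdot,\cdot\rangle$ is the standard (trace) inner product of matrices, $\mathbf{M}\succeq\mathbf{0}$ means that $\mathbf{M}$ is symmetric positive semidefinite, and $\mathbf{M}\ge\mathbf{0}$ means entrywise non-negativity. $\omega(G)$ is the clique number and $\chi(G)$ the chromatic number; $G$ is perfect if $\omega(H)=\chi(H)$ for all induced subgraphs $H$ of $G$. For any simple graph $G$ on $[n]$, the projection $\vartheta$-number is $$\hat{\vartheta}(G)=\min\left\{\operatorname{tr}(\mathbf{R}) : \mathbf{R}\in\mathbb{R}^{n\times n},\ \mathbf{R}\succeq\mathbf{0},\ \mathbf{R}\mathbf{e}=\mathbf{e},\ \langle\mathbf{R},\mathbf{A}_{\overline{G}}\rangle=0,\ \mathbf{R}\ge\mathbf{0}\right\}$$ and the Szegedy number is $$\vartheta^+(G)=\min\left\{x_0 : x_0\in\mathbb{R},\ \mathbf{X}\in\mathbb{R}^{n\times n},\ \begin{pmatrix}x_0&\mathbf{e}^\top\\ \mathbf{e}&\mathbf{X}\end{pmatrix}\succeq\mathbf{0},\ \operatorname{diag}(\mathbf{X})=\mathbf{e},\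 \langle\mathbf{X},\mathbf{A}_{\overline{G}}\rangle=0,\ \mathbf{X}\ge\mathbf{0}\right\}.$$ *)

(* Defs.v *)
From mathcomp Require Import all_boot all_order all_algebra all_fingroup.
From mathcomp Require Import boolp classical_sets reals topology normedtype.
From mathcomp Require Import derive.
From mathcomp Require Import ring lra.

Set Implicit Arguments.
Unset Strict Implicit.
Unset Printing Implicit Defensive.

Import Order.TTheory GRing.Theory Num.Theory.
Import numFieldNormedType.Exports.
Local Open Scope ring_scope.

(* The node set [n] = {1, ..., n} is rendered as 'I_n; graphs are defined over
   an arbitrary finType so that induced subgraphs are again graphs. *)
Record sgraph (T : finType) := SGraph {
  adjacent :> rel T;
  adjacent_sym : symmetric adjacent;
  adjacent_irr : irreflexive adjacent
}.

Section Graphs.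
Variables (T : finType) (G : sgraph T).

Definition compl_rel : rel T := [rel x y | (x != y) && ~~ G x y].

Lemma compl_rel_sym : symmetric compl_rel.
Proof. by move=> x y; rewrite /compl_rel /= eq_sym adjacent_sym. Qed.

Lemma compl_rel_irr : irreflexive compl_rel.
Proof. by move=> x; rewrite /compl_rel /= eqxx. Qed.

Definition compl : sgraph T := SGraph compl_rel_sym compl_rel_irr.

Section Induced.
Variable S : {set T}.

Definition induced_rel : rel {x : T | x \in S} :=
  [rel x y | G (val x) (val y)].

Lemma induced_rel_sym : symmetric induced_rel.
Proof. by move=> x y; exact: adjacent_sym. Qed.

Lemma induced_rel_irr : irreflexive induced_rel.
Proof. by move=> x; exact: adjacent_irr. Qed.

Definition induced : sgraph {x : T | x \in S} :=
  SGraph induced_rel_sym induced_rel_irr.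

End Induced.

Definition clique (K : {set T}) : bool :=
  [forall x in K, forall y in K, (x != y) ==> G x y].

Definition omega : nat := \max_(K : {set T} | clique K) #|K|.

Definition colorable (k : nat) : bool :=
  [exists c : {ffun T -> 'I_k}, forall x, forall y, G x y ==> (c x != c y)].

Lemma colorable_ex : exists k, colorable k.
Proof.
exists #|T|; apply/existsP; exists [ffun x => enum_rank x].
apply/forallP => x; apply/forallP => y; apply/implyP => Gxy; rewrite !ffunE.
by apply: contraTneq Gxy => /enum_rank_inj ->; rewrite adjacent_irr.
Qed.

Definition chi : nat := ex_minn colorable_ex.

Definition autG : {set {perm T}} :=
  [set s : {perm T} | [forall x, forall y, G (s x) (s y) == G x y]].

(* [transitive _, on S | _] fails when S is empty. *)
Definition vertex_transitive : bool := [transitive autG, on [set: T] | 'P].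

End Graphs.

Definition perfect (T : finType) (G : sgraph T) : Prop :=
  forall S : {set T}, omega (induced G S) = chi (induced G S).

(* The real numbers are an arbitrary model [R : realType] of the reals. *)
Section SDP.
Variable R : realType.

Definition adjmx n (G : sgraph 'I_n) : 'M[R]_n := \matrix_(i, j) (G i j)%:R.

Definition ones n : 'cV[R]_n := const_mx 1.

Definition mxdot m n (A B : 'M[R]_(m, n)) : R := \tr (A^T *m B).

Definition psdmx n (M : 'M[R]_n) : Prop :=
  M^T = M /\ forall x : 'cV[R]_n, 0 <= (x^T *m M *m x) 0 0.

Definition nonneg_mx m n (M : 'M[R]_(m, n)) : Prop := forall i j, 0 <= M i j.

Definition theta_hat_feasible n (G : sgraph 'I_n) (M : 'M[R]_n) : Prop :=
  [/\ psdmx M, M *m ones n = ones n,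
      mxdot M (adjmx (compl G)) = 0 & nonneg_mx M].

Definition theta_hat_values n (G : sgraph 'I_n) : set R :=
  [set t | exists2 M : 'M[R]_n, theta_hat_feasible G M & t = \tr M]%classic.

Definition theta_plus_feasible n (G : sgraph 'I_n) (x0 : R) (X : 'M[R]_n) :
    Prop :=
  [/\ psdmx (block_mx x0%:M (ones n)^T (ones n) X : 'M[R]_(1 + n)),
      forall i, X i i = 1,
      mxdot X (adjmx (compl G)) = 0 & nonneg_mx X].

Definition theta_plus_values n (G : sgraph 'I_n) : set R :=
  [set x0 | exists X : 'M[R]_n, theta_plus_feasible G x0 X]%classic.

(* [inf] is a total operator; the lemmas [theta_hat_min] and [theta_plus_min]
   below show that both infima are attained, hence are genuine minima. *)
Definition theta_hat n (G : sgraph 'I_n) : R := inf (theta_hat_values G).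

Definition theta_plus n (G : sgraph 'I_n) : R := inf (theta_plus_values G).

Definition is_minimum (S : set R) (m : R) : Prop :=
  S m /\ forall t, S t -> m <= t.

Lemma inf_minimum (S : set R) m : is_minimum S m -> inf S = m.
Proof.
move=> [Sm lbm]; apply/eqP; rewrite eq_le; apply/andP; split.
  by apply: ge_inf => //; exists m.
by apply: lb_le_inf; [exists m | exact: lbm].
Qed.

Lemma quadE n (M : 'M[R]_n) (x : 'cV[R]_n) :
  (x^T *m M *m x) 0 0 = \sum_i \sum_j x i 0 * M i j * x j 0.
Proof.
rewrite mxE exchange_big; apply: eq_bigr => j _.
by rewrite mxE mulr_suml; apply: eq_bigr => i _; rewrite !mxE.
Qed.

Lemma psd_diag n (M : 'M[R]_n) i : psdmx M -> 0 <= M i i.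
Proof.
move=> [_ /(_ (delta_mx i 0))].
by rewrite trmx_delta -rowE -colE !mxE.
Qed.

Lemma psd_offdiag n (M : 'M[R]_n) i j : psdmx M -> 2 * M i j <= M i i + M j j.
Proof.
move=> [Msym /(_ (delta_mx i 0 - delta_mx j 0))].
have Mij : M j i = M i j by rewrite -[in LHS]Msym mxE.
have -> : (delta_mx i 0 - delta_mx j 0 : 'cV[R]_n)^T =
    delta_mx 0 i - delta_mx 0 j by rewrite linearB /= !trmx_delta.
rewrite !mulmxBl !mulmxBr -!rowE -!colE !mxE Mij; lra.
Qed.

Lemma mxdotE m n (A B : 'M[R]_(m, n)) :
  mxdot A B = \sum_j \sum_i A i j * B i j.
Proof.
apply: eq_bigr => j _; rewrite mxE; apply: eq_bigr => i _.
by rewrite mxE.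
Qed.

Local Open Scope classical_set_scope.

Section Compactness.
Variable N : nat.

Let entry (i j : 'I_N) : 'rV[R]_(N * N) -> R := fun v => vec_mx v i j.

Lemma entry_continuous i j : continuous (entry i j).
Proof.
rewrite (_ : entry i j = fun v => v 0 (mxvec_index i j)).
  exact: coord_continuous.
by apply/funext => v; rewrite /entry mxE.
Qed.

Lemma bigsum_continuous (T : topologicalType) (I : finType)
    (F : I -> T -> R) :
  (forall i, continuous (F i)) -> continuous (fun v => \sum_i F i v).
Proof.
move=> Fc; suff Fr r : continuous (fun v => \sum_(i <- r) F i v) by exact: Fr.
elim: r => [|i r IHr].
  rewrite (_ : (fun _ => _) = fun=> 0); first exact: cst_continuous.
  by apply/funext => v; rewrite big_nil.
rewrite (_ : (fun _ => _) = fun v => F i v + \sum_(j <- r) F j v).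
  by move=> v; apply: cvgD; [exact: Fc | exact: IHr].
by apply/funext => v; rewrite big_cons.
Qed.

Lemma sub_continuous (T : topologicalType) (f g : T -> R) :
  continuous f -> continuous g -> continuous (fun v => f v - g v).
Proof. by move=> cf cg v; apply: cvgB; [exact: cf | exact: cg]. Qed.

Lemma scale_continuous (T : topologicalType) (f : T -> R) (a : R) :
  continuous f -> continuous (fun v => f v * a).
Proof. by move=> cf v; apply: cvgM; [exact: cf | exact: cvg_cst]. Qed.

Lemma closed_feasible_ge (T : topologicalType) (f : T -> R) (a : R) :
  continuous f -> closed [set v | a <= f v].
Proof.
by move=> cf; apply: (preimage_closed _ (@closed_ge _ a)) => y _; exact: cf.
Qed.

Lemma closed_feasible_le (T : topologicalType) (f : T -> R) (a : R) :
  continuous f -> closed [set v | f v <= a].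
Proof.
by move=> cf; apply: (preimage_closed _ (@closed_le _ a)) => y _; exact: cf.
Qed.

Lemma closed_feasible_eq (T : topologicalType) (f : T -> R) (a : R) :
  continuous f -> closed [set v | f v = a].
Proof.
by move=> cf; apply: (preimage_closed _ (@closed_eq _ a)) => y _; exact: cf.
Qed.

Lemma closed_feasible_all (T : topologicalType) (I : Type) (P : I -> T -> Prop) :
  (forall i, closed [set v | P i v]) -> closed [set v | forall i, P i v].
Proof.
move=> Pc; rewrite (_ : mkset _ = \bigcap_(i in setT) [set v | P i v]).
  by apply: closed_bigI => i _; exact: Pc.
by apply/seteqP; split=> [v /= Pv i _|v /= Pv i]; [exact: Pv | exact: (Pv i)].
Qed.

Lemma mxdot_continuous (A : 'M[R]_N) :
  continuous (fun v : 'rV[R]_(N * N) => mxdot (vec_mx v) A).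
Proof.
rewrite (_ : (fun _ => _) = fun v => \sum_j \sum_i entry i j v * A i j).
  do 2![apply: bigsum_continuous => ?]; apply: scale_continuous.
  exact: entry_continuous.
by apply/funext => v; rewrite mxdotE.
Qed.

Lemma closed_psd : closed [set v : 'rV[R]_(N * N) | psdmx (vec_mx v)].
Proof.
apply: closedI.
  rewrite [X in closed X](_ : _ =
    [set v | forall i j, entry i j v - entry j i v = 0]).
    do 2![apply: closed_feasible_all => ?]; apply: closed_feasible_eq.
    by apply: sub_continuous => w; exact: entry_continuous.
  apply/seteqP; split => v /=.
    by move=> vE i j; rewrite /entry -[in X in _ - X]vE [X in _ - X]mxE subrr.
  move=> vE; apply/matrixP => i j; rewrite mxE.
  by apply/eqP; rewrite -subr_eq0; apply/eqP; exact: vE.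
apply: closed_feasible_all => x; apply: closed_feasible_ge.
rewrite (_ : (fun _ => _) =
             fun v => \sum_i \sum_j entry i j v * (x i 0 * x j 0)).
  do 2![apply: bigsum_continuous => ?]; apply: scale_continuous.
  exact: entry_continuous.
apply/funext => v; rewrite quadE; apply: eq_bigr => i _; apply: eq_bigr => j _.
by rewrite /entry; ring.
Qed.

Lemma attained (P : 'M[R]_N -> Prop) (b : R) (c : 'M[R]_N -> R) :
  (exists M, P M) ->
  closed [set v : 'rV[R]_(N * N) | P (vec_mx v)] ->
  (forall M, P M -> forall i j, 0 <= M i j <= b) ->
  continuous (fun v : 'rV[R]_(N * N) => c (vec_mx v)) ->
  exists2 M, P M & forall M', P M' -> c M <= c M'.
Proof.
move=> [M0 PM0] Pc Pb cc.
pose A := [set v : 'rV[R]_(N * N) | P (vec_mx v)].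
have A0 : A !=set0 by exists (mxvec M0); rewrite /A /= mxvecK.
have cA : compact A.
  apply: (subclosed_compact Pc
    (@rV_compact _ _ (fun=> `[0, b]%classic) (fun=> @segment_compact _ 0 b))).
  move=> v /= Pv k; rewrite in_itv /=.
  case/mxvec_indexP: k => i j.
  by have := Pb _ Pv i j; rewrite mxE.
have [v vA vmin] := compact_EVT_min A0 cA (continuous_subspaceT cc).
exists (vec_mx v); first by move: vA; rewrite inE.
move=> M' PM'; rewrite -[M']mxvecK; apply: vmin.
by rewrite inE /A /= mxvecK.
Qed.

End Compactness.

Lemma mxdot1_compl n (G : sgraph 'I_n) : mxdot 1%:M (adjmx (compl G)) = 0.
Proof.
rewrite mxdotE big1 // => j _; rewrite big1 // => i _; rewrite !mxE.
have [->|_] := eqVneq i j; last by rewrite mul0r.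
by rewrite adjacent_irr mulr0.
Qed.

Lemma nonneg1 n : nonneg_mx (1%:M : 'M[R]_n).
Proof. by move=> i j; rewrite mxE ler0n. Qed.

Lemma mulmx_onesE n (M : 'M[R]_n) i : (M *m ones n) i 0 = \sum_j M i j.
Proof. by rewrite mxE; apply: eq_bigr => j _; rewrite mxE mulr1. Qed.

Lemma ones_quad n (x0 : R) (X : 'M[R]_n) (a : 'cV[R]_1) (x : 'cV[R]_n) :
  ((col_mx a x)^T *m block_mx x0%:M (ones n)^T (ones n) X *m col_mx a x) 0 0 =
  x0 * a 0 0 ^+ 2 + 2 * a 0 0 * \sum_i x i 0 + (x^T *m X *m x) 0 0.
Proof.
rewrite tr_col_mx mul_row_block mul_row_col !mulmxDl !mxE !big_ord1.
have -> : (\sum_j (a^T *m (ones n)^T) 0 j * x j 0) = a 0 0 * \sum_i x i 0.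
  by rewrite mulr_sumr; apply: eq_bigr => j _; rewrite !mxE big_ord1 !mxE mulr1.
have -> : (x^T *m ones n) 0 0 = \sum_i x i 0.
  by rewrite mxE; apply: eq_bigr => j _; rewrite !mxE mulr1.
by rewrite !mxE big_ord1 !mxE eqxx mulr1n; ring.
Qed.

Lemma theta_hat_min n (G : sgraph 'I_n) :
  is_minimum (theta_hat_values G) (theta_hat G).
Proof.
suff [M MG Mmin] : exists2 M, theta_hat_feasible G M &
    forall M', theta_hat_feasible G M' -> \tr M <= \tr M'.
  suff Mm : is_minimum (theta_hat_values G) (\tr M).
    by rewrite /theta_hat (inf_minimum Mm).
  by split=> [|t [M' M'G ->]]; [exists M | exact: Mmin].
apply: (@attained _ _ 1).
- exists 1%:M; split; [|by rewrite mul1mx|exact: mxdot1_compl|exact: nonneg1].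
  split; first exact: trmx1.
  move=> x; rewrite mulmx1 mxE; apply: sumr_ge0 => i _.
  by rewrite mxE -expr2 sqr_ge0.
- rewrite (_ : mkset _ = [set v : 'rV[R]_(n * n) | psdmx (vec_mx v)] `&`
    ([set v | forall i, \sum_j vec_mx v i j = 1] `&`
    ([set v | mxdot (vec_mx v) (adjmx (compl G)) = 0] `&`
     [set v | forall i j, 0 <= vec_mx v i j]))).
    apply: closedI; first exact: closed_psd.
    apply: closedI.
      apply: closed_feasible_all => i; apply: closed_feasible_eq.
      by apply: bigsum_continuous => j; exact: entry_continuous.
    apply: closedI; first by apply: closed_feasible_eq; exact: mxdot_continuous.
    do 2![apply: closed_feasible_all => ?]; apply: closed_feasible_ge.
    exact: entry_continuous.
  apply/seteqP; split => v /=.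
    move=> [psdv ve vA v0]; split=> //; split=> // i.
    by rewrite -mulmx_onesE ve mxE.
  move=> [psdv [ve [vA v0]]]; split=> //.
  by apply/colP => i; rewrite mulmx_onesE ve mxE.
- move=> M [_ Me _ M0] i j; rewrite M0 /=.
  have <- : \sum_j M i j = 1 by rewrite -mulmx_onesE Me mxE.
  by rewrite (bigD1 j) //= lerDl sumr_ge0.
- by apply: bigsum_continuous => i; exact: entry_continuous.
Qed.

(* The sublevel set [x0 <= n], encoded by the whole bordered matrix, is
   nonempty (it contains x0 = n, X = 1) and compact. *)
Lemma theta_plus_min n (G : sgraph 'I_n) :
  is_minimum (theta_plus_values G) (theta_plus G).
Proof.
pose Y (x0 : R) (X : 'M[R]_n) : 'M[R]_(1 + n) :=
  block_mx x0%:M (ones n)^T (ones n) X.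
pose P (M : 'M[R]_(1 + n)) :=
  exists x0 X, [/\ M = Y x0 X, theta_plus_feasible G x0 X & x0 <= n%:R].
have Y00 x0 X : Y x0 X (lshift n 0) (lshift n 0) = x0.
  by rewrite block_mxEul mxE eqxx mulr1n.
have feas0 : theta_plus_feasible G n%:R 1%:M.
  split; [|by move=> i; rewrite mxE eqxx|exact: mxdot1_compl|exact: nonneg1].
  split.
    by rewrite tr_block_mx tr_scalar_mx trmx1 trmxK.
  move=> z; rewrite -[z]vsubmxK ones_quad.
  move: (usubmx z) (dsubmx z) => a x.
  rewrite mulmx1 (_ : _ + _ = \sum_i (a 0 0 + x i 0) ^+ 2).
    by apply: sumr_ge0 => i _; exact: sqr_ge0.
  rewrite [(_ *m _) 0 0]mxE (_ : \sum_i (a 0 0 + x i 0) ^+ 2 =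
    \sum_(i < n) (a 0 0 ^+ 2 + (2 * a 0 0 * x i 0 + x i 0 ^+ 2))).
    rewrite !big_split /= sumr_const card_ord mulr_natl -addrA mulr_sumr.
    by congr (_ + (_ + _)); apply: eq_bigr => i _; rewrite mxE expr2.
  by apply: eq_bigr => i _; ring.
suff [M [x0 [X [-> XG x0n]]] Mmin] : exists2 M, P M & forall M', P M' ->
    M (lshift n 0) (lshift n 0) <= M' (lshift n 0) (lshift n 0).
  suff Mm : is_minimum (theta_plus_values G) x0.
    by rewrite /theta_plus (inf_minimum Mm).
  split=> [|t [X' X'G]]; first by exists X.
  have [tn|/ltW nt] := leP t n%:R; last exact: le_trans nt.
  by have := Mmin (Y t X'); rewrite !Y00; apply; exists t, X'.
apply: (@attained _ _ (n%:R + 1)).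
- by exists (Y n%:R 1%:M), n%:R, 1%:M.
- rewrite (_ : mkset _ =
    [set v : 'rV[R]_((1 + n) * (1 + n)) | psdmx (vec_mx v)] `&`
    ([set v | forall i, vec_mx v (rshift 1 i) (lshift n 0) = 1] `&`
    ([set v | forall i, vec_mx v (rshift 1 i) (rshift 1 i) = 1] `&`
    ([set v | \sum_j \sum_i (vec_mx v (rshift 1 i) (rshift 1 j)
                             * adjmx (compl G) i j) = 0] `&`
    ([set v | forall i j, 0 <= vec_mx v (rshift 1 i) (rshift 1 j)] `&`
     [set v | vec_mx v (lshift n 0) (lshift n 0) <= n%:R]))))).
    apply: closedI; first exact: closed_psd.
    apply: closedI.
      apply: closed_feasible_all => i; apply: closed_feasible_eq.
      exact: entry_continuous.
    apply: closedI.
      apply: closed_feasible_all => i; apply: closed_feasible_eq.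
      exact: entry_continuous.
    apply: closedI.
      apply: closed_feasible_eq; do 2![apply: bigsum_continuous => ?].
      by apply: scale_continuous; exact: entry_continuous.
    apply: closedI.
      do 2![apply: closed_feasible_all => ?]; apply: closed_feasible_ge.
      exact: entry_continuous.
    by apply: closed_feasible_le; exact: entry_continuous.
  apply/seteqP; split => v /=; move: (vec_mx v) => M.
    move=> [x0 [X [-> [psdX dX XA X0] x0n]]]; rewrite Y00; split=> //.
    split; first by move=> i; rewrite block_mxEdl mxE.
    split; first by move=> i; rewrite block_mxEdr dX.
    split.
      rewrite -[RHS]XA mxdotE; apply: eq_bigr => j _; apply: eq_bigr => i _.
      by rewrite block_mxEdr.
    by split=> // i j; rewrite block_mxEdr.
  move=> [psdM [M1 [Md [MA [M0 Mn]]]]].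
  have MY : M = Y (M (lshift n 0) (lshift n 0)) (drsubmx M).
    rewrite -[LHS]submxK; congr block_mx.
    - by apply/matrixP => i j; rewrite !ord1 !mxE eqxx mulr1n.
    - apply/matrixP => i j; rewrite ord1 !mxE -[RHS](M1 j).
      by rewrite -[in RHS]psdM.1 mxE.
    - by apply/matrixP => i j; rewrite ord1 !mxE M1.
  exists (M (lshift n 0) (lshift n 0)), (drsubmx M); split=> //; split.
  + by rewrite -/(Y _ _) -MY.
  + by move=> i; rewrite !mxE.
  + rewrite -[RHS]MA mxdotE; apply: eq_bigr => j _; apply: eq_bigr => i _.
    by rewrite !mxE.
  + by move=> i j; rewrite !mxE.
- move=> _ [x0 [X [-> [psdX dX XA X0] x0n]]] i j.
  have n0 : 0 <= n%:R :> R by exact: ler0n.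
  have x00 : 0 <= x0 by have := psd_diag (lshift n 0) psdX; rewrite -/(Y _ _) Y00.
  have X1 k l : X k l <= 1.
    have := psd_offdiag (rshift 1 k) (rshift 1 l) psdX.
    by rewrite !block_mxEdr !dX; lra.
  rewrite /Y; case: (split_ordP i) => k ->; case: (split_ordP j) => l ->.
  + by rewrite block_mxEul !ord1 mxE eqxx mulr1n; lra.
  + by rewrite block_mxEur !mxE; lra.
  + by rewrite block_mxEdl !mxE; lra.
  + by rewrite block_mxEdr X0 /=; have := X1 k l; lra.
- exact: entry_continuous.
Qed.

End SDP.

(* Main.v *)
Require Import Defs.
From mathcomp Require Import all_boot all_order all_algebra all_fingroup.
From mathcomp Require Import reals.
From mathcomp Require Import ring.

Import Order.TTheory GRing.Theory Num.Theory.
Local Open Scope ring_scope.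

Set Implicit Arguments.
Unset Strict Implicit.
Unset Printing Implicit Defensive.

(** The two programs become the same once their variables are averaged over
    the automorphism group. Averaging keeps every constraint and, when the group
    is transitive, makes the diagonal and the row sums constant. So a matrix
    feasible for either program is, up to a scalar, feasible for the other, and
    only the scalar has to be computed.

    From M feasible for [theta_hat] with trace t, the matrix X = (n / t) M' with
    M' the mean of M has unit diagonal. As e is an eigenvector of M' for the
    eigenvalue 1, the matrix M' - ee^T / n is positive semidefinite
    ([sum_sqr_le_psd]), hence so is X - ee^T / t. By a Schur complement this
    says that (t, X) is feasible for [theta_plus]; see [theta_plus_le_hat].
    Conversely, let (x0, X) be feasible for [theta_plus] and let T be the sum of
    the entries of X. Then (n / T) X', with X' the mean of X, has row sums 1 and
    trace n^2 / T, and testing the bordered matrix on the vector (- T / n, e)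
    gives n^2 / T <= x0 ([theta_plus_feasible_total], [theta_hat_le_plus]).

    For the second claim, [theta_hat] of the complement lies between the clique
    and chromatic numbers. A clique K picks out a diagonal principal submatrix
    of the averaged optimum, whose diagonal entries are t / n; the inequality
    1_K^T M' 1_K >= |K|^2 / n then gives t >= |K| ([clique_le_theta_hat]). In the
    other direction, the orthogonal projection on the vectors that are constant
    on each colour class is feasible and its trace is the number of nonempty
    classes ([color_mx_tr], [theta_hat_le_chi]). Perfection applied to the whole
    vertex set closes the gap. *)

(** * Positive semidefinite matrices *)

Lemma psdmxP (R : realType) n (M : 'M[R]_n) :
  psdmx M <-> (forall i j, M i j = M j i) /\
    forall x : 'I_n -> R, 0 <= \sum_i \sum_j x i * M i j * x j.
Proof.
split=> [[Msym Mge0]|[Msym Mge0]].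
  split=> [i j|x]; first by rewrite -[in LHS]Msym mxE.
  have := Mge0 (\col_i x i); rewrite quadE.
  by under eq_bigr do under eq_bigr do rewrite !mxE.
by split=> [|x]; [apply/matrixP => i j; rewrite mxE | rewrite quadE].
Qed.

Lemma psdmxZ (R : realType) n (a : R) (M : 'M[R]_n) :
  0 <= a -> psdmx M -> psdmx (a *: M).
Proof.
move=> a0 [Msym Mge0]; split=> [|x]; first by rewrite linearZ /= Msym.
by rewrite -scalemxAr -scalemxAl mxE mulr_ge0.
Qed.

(** As e is an eigenvector of [M] for the eigenvalue 1, the cross terms depend
    on [x] only through the sum of its entries. *)
Lemma quad_shift (R : realType) n (M : 'M[R]_n) (x : 'I_n -> R) (a : R) :
  (forall i j, M i j = M j i) -> (forall i, \sum_j M i j = 1) ->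
  \sum_i \sum_j (x i - a) * M i j * (x j - a) =
  \sum_i \sum_j x i * M i j * x j - 2 * a * \sum_i x i + a ^+ 2 * n%:R.
Proof.
move=> Msym Me.
have Mx : \sum_i \sum_j M i j * x j = \sum_i x i.
  rewrite exchange_big; apply: eq_bigr => j _.
  by rewrite -mulr_suml (eq_bigr (M j)) // Me mul1r.
have xM : \sum_i \sum_j x i * M i j = \sum_i x i.
  by apply: eq_bigr => i _; rewrite -mulr_sumr Me mulr1.
have MM : \sum_i \sum_j M i j = n%:R.
  by under eq_bigr do rewrite Me; rewrite sumr_const card_ord.
rewrite mulr2n mulrDl mul1r mulrDl opprD -{1}Mx -xM -MM !mulr_sumr addrA.
rewrite -!sumrN -!big_split /=; apply: eq_bigr => i _.
rewrite !mulr_sumr -!sumrN -!big_split /=; apply: eq_bigr => j _.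
by ring.
Qed.

(** * Averaging over the automorphism group *)

Lemma autGP n (G : sgraph 'I_n) (s : {perm 'I_n}) :
  reflect (forall i j, G (s i) (s j) = G i j) (s \in autG G).
Proof.
rewrite inE; apply: (iffP forallP) => [sG i j|sG i].
  by have /forallP/(_ j)/eqP := sG i.
by apply/forallP => j; rewrite sG.
Qed.

Lemma autG_mul n (G : sgraph 'I_n) (s t : {perm 'I_n}) :
  s \in autG G -> ((s * t)%g \in autG G) = (t \in autG G).
Proof.
move=> /autGP sG; apply/autGP/autGP => tG i j; last by rewrite !permM tG sG.
have := tG (s^-1%g i) (s^-1%g j); rewrite !permM !permKV => ->.
by rewrite -sG !permKV.
Qed.

Lemma autG_compl n (G : sgraph 'I_n) : autG (compl G) = autG G.
Proof.
apply/setP => s; apply/autGP/autGP => sG i j; last first.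
  by rewrite /= /compl_rel /= sG (inj_eq perm_inj).
have [->|ij] := eqVneq i j; first by rewrite !adjacent_irr.
apply/negb_inj; have := sG i j.
by rewrite /= /compl_rel /= (inj_eq perm_inj) ij.
Qed.

Lemma vertex_transitive_compl n (G : sgraph 'I_n) :
  vertex_transitive (compl G) = vertex_transitive G.
Proof. by rewrite /vertex_transitive autG_compl. Qed.

Lemma card_autG_gt0 n (G : sgraph 'I_n) : (0 < #|autG G|)%N.
Proof.
by apply/card_gt0P; exists 1%g; apply/autGP => i j; rewrite !perm1.
Qed.

Lemma vertex_transitiveP n (G : sgraph 'I_n) : vertex_transitive G ->
  forall i j, exists2 s, s \in autG G & s i = j.
Proof.
case/imsetP => k _ orbk i j.
have orb l : exists2 s, s \in autG G & l = s k.
  by have : l \in [set: 'I_n] by []; rewrite orbk => /imsetP[s]; exists s.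
have [[s sG ->] [t tG ->]] := (orb i, orb j).
exists (s^-1 * t)%g; last by rewrite permM permK.
by rewrite -(autG_mul _ sG) mulKVg.
Qed.

(** The Reynolds operator of the action of [autG G] by simultaneous permutation
    of rows and columns. *)
Definition aut_mean (R : realType) n (G : sgraph 'I_n) (M : 'M[R]_n) :
    'M[R]_n :=
  #|autG G|%:R^-1 *: \sum_(s in autG G) mxsub s s M.

Lemma aut_meanE (R : realType) n (G : sgraph 'I_n) (M : 'M[R]_n) i j :
  aut_mean G M i j = #|autG G|%:R^-1 * \sum_(s in autG G) M (s i) (s j).
Proof. by rewrite mxE summxE; under eq_bigr do rewrite mxE. Qed.

Lemma mean_const (R : realType) n (G : sgraph 'I_n) (a : R) :
  #|autG G|%:R^-1 * \sum_(s in autG G) a = a.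
Proof.
rewrite sumr_const -[a *+ _]mulr_natl mulrA mulVf ?mul1r //.
by rewrite pnatr_eq0 -lt0n card_autG_gt0.
Qed.

Lemma aut_mean_ge0 (R : realType) n (G : sgraph 'I_n) (M : 'M[R]_n) :
  nonneg_mx M -> nonneg_mx (aut_mean G M).
Proof.
move=> M0 i j; rewrite aut_meanE mulr_ge0 ?invr_ge0 ?ler0n //.
by apply: sumr_ge0.
Qed.

(** Pairing with a weight [w] is the common form of the trace, of [mxdot], of
    the sum of the entries and of the quadratic form at a vector: permuting the
    matrix amounts to permuting [w] by the inverse. *)
Lemma aut_mean_sum (R : realType) n (G : sgraph 'I_n) (M : 'M[R]_n)
    (w : 'I_n -> 'I_n -> R) :
  \sum_i \sum_j aut_mean G M i j * w i j =
  #|autG G|%:R^-1 *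
    \sum_(s in autG G) \sum_i \sum_j M i j * w (s^-1%g i) (s^-1%g j).
Proof.
under eq_bigr do under eq_bigr do rewrite aut_meanE -mulrA mulr_suml.
under eq_bigr do rewrite -mulr_sumr exchange_big.
rewrite -mulr_sumr exchange_big; congr (_ * _); apply: eq_bigr => s _.
rewrite [RHS](reindex_inj (@perm_inj _ s)); apply: eq_bigr => i _.
rewrite [RHS](reindex_inj (@perm_inj _ s)); apply: eq_bigr => j _.
by rewrite !permK.
Qed.

Lemma aut_mean_sum_inv (R : realType) n (G : sgraph 'I_n) (M : 'M[R]_n)
    (w : 'I_n -> 'I_n -> R) :
  (forall s i j, s \in autG G -> w (s i) (s j) = w i j) ->
  \sum_i \sum_j aut_mean G M i j * w i j = \sum_i \sum_j M i j * w i j.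
Proof.
move=> winv; rewrite aut_mean_sum -[RHS](mean_const G); congr (_ * _).
apply: eq_bigr => s sG; apply: eq_bigr => i _; apply: eq_bigr => j _.
by rewrite -(winv s) // !permKV.
Qed.

Lemma aut_mean_psd (R : realType) n (G : sgraph 'I_n) (M : 'M[R]_n) :
  psdmx M -> psdmx (aut_mean G M).
Proof.
move=> /psdmxP[Msym Mge0]; apply/psdmxP; split=> [i j|x].
  by rewrite !aut_meanE; under eq_bigr do rewrite Msym.
(* The weight is x_i x_j; permuting it evaluates the form at a permuted x. *)
under eq_bigr do under eq_bigr do rewrite mulrAC mulrC.
rewrite aut_mean_sum mulr_ge0 ?invr_ge0 ?ler0n //; apply: sumr_ge0 => s _.
under eq_bigr do under eq_bigr do rewrite mulrC mulrAC.
exact: Mge0.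
Qed.

Lemma mxdot_sum (R : realType) n (M A : 'M[R]_n) :
  mxdot M A = \sum_i \sum_j M i j * A i j.
Proof. by rewrite mxdotE exchange_big. Qed.

Lemma aut_mean_dot (R : realType) n (G : sgraph 'I_n) (M : 'M[R]_n) :
  mxdot (aut_mean G M) (adjmx R (compl G)) = mxdot M (adjmx R (compl G)).
Proof.
rewrite !mxdot_sum; apply: aut_mean_sum_inv => s i j.
by rewrite -autG_compl => /autGP sG; rewrite !mxE sG.
Qed.

Lemma mxtr_sum (R : realType) n (M : 'M[R]_n) :
  \tr M = \sum_i \sum_j M i j * (i == j)%:R.
Proof.
apply: eq_bigr => i _; rewrite (bigD1 i) //= eqxx mulr1 big1 ?addr0 // => j ji.
by rewrite eq_sym (negbTE ji) mulr0.
Qed.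

Lemma aut_mean_tr (R : realType) n (G : sgraph 'I_n) (M : 'M[R]_n) :
  \tr (aut_mean G M) = \tr M.
Proof.
rewrite !mxtr_sum; apply: aut_mean_sum_inv => s i j _.
by rewrite (inj_eq perm_inj).
Qed.

Lemma aut_mean_total (R : realType) n (G : sgraph 'I_n) (M : 'M[R]_n) :
  \sum_i \sum_j aut_mean G M i j = \sum_i \sum_j M i j.
Proof.
have total (N : 'M[R]_n) : \sum_i \sum_j N i j = \sum_i \sum_j N i j * 1.
  by do 2![apply: eq_bigr => ? _]; rewrite mulr1.
by rewrite !total (@aut_mean_sum_inv R n G M (fun _ _ => 1)).
Qed.

(** Left multiplication by [s] permutes the group, so the mean is unchanged. *)
Lemma aut_mean_inv (R : realType) n (G : sgraph 'I_n) (M : 'M[R]_n) s i j :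
  s \in autG G -> aut_mean G M (s i) (s j) = aut_mean G M i j.
Proof.
move=> sG; rewrite !aut_meanE [in RHS](reindex_inj (mulgI s)); congr (_ * _).
by apply: eq_big => t; rewrite ?autG_mul // !permM.
Qed.

Lemma transitive_mean (R : realType) n (G : sgraph 'I_n) (f : 'I_n -> R) :
  vertex_transitive G -> (forall s i, s \in autG G -> f (s i) = f i) ->
  forall i, n%:R * f i = \sum_j f j.
Proof.
move=> /vertex_transitiveP tG finv i.
rewrite -[n in n%:R]card_ord mulr_natl -sumr_const; apply: eq_bigr => j _.
by have [s sG <-] := tG i j; rewrite finv.
Qed.

Lemma aut_mean_diag (R : realType) n (G : sgraph 'I_n) (M : 'M[R]_n) i :
  vertex_transitive G -> n%:R * aut_mean G M i i = \tr M.
Proof.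
move=> tG; rewrite -(aut_mean_tr G).
apply: (transitive_mean (f := fun i => aut_mean G M i i) tG) => s j.
exact: aut_mean_inv.
Qed.

Lemma aut_mean_row (R : realType) n (G : sgraph 'I_n) (M : 'M[R]_n) i :
  vertex_transitive G ->
  n%:R * \sum_j aut_mean G M i j = \sum_k \sum_j M k j.
Proof.
move=> tG; rewrite -(aut_mean_total G).
apply: (transitive_mean (f := fun i => \sum_j aut_mean G M i j) tG) => s k sG.
rewrite (reindex_inj (@perm_inj _ s)); apply: eq_bigr => j _.
exact: aut_mean_inv.
Qed.

(** * Equality of the two theta numbers *)

Lemma mul_onesP (R : realType) n (M : 'M[R]_n) :
  M *m ones R n = ones R n <-> forall i, \sum_j M i j = 1.
Proof.
split=> [Me i|Me]; first by rewrite -mulmx_onesE Me mxE.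
by apply/colP => i; rewrite mulmx_onesE Me mxE.
Qed.

Lemma theta_hat_aut_mean (R : realType) n (G : sgraph 'I_n) (M : 'M[R]_n) :
  (0 < n)%N -> vertex_transitive G ->
  theta_hat_feasible G M -> theta_hat_feasible G (aut_mean G M).
Proof.
move=> n0 tG [psdM /mul_onesP Me MA M0]; split.
- exact: aut_mean_psd.
- have nn0 : n%:R != 0 :> R by rewrite pnatr_eq0 -lt0n.
  apply/mul_onesP => i; apply: (mulfI nn0); rewrite aut_mean_row //.
  by under eq_bigr do rewrite Me; rewrite sumr_const card_ord mulr1.
- by rewrite aut_mean_dot.
- exact: aut_mean_ge0.
Qed.

(** This is positivity of M - ee^T / n. It follows by removing from [x] its
    component along the eigenvector e, that is, by subtracting its mean. *)
Lemma sum_sqr_le_psd (R : realType) n (M : 'M[R]_n) (x : 'I_n -> R) :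
  (0 < n)%N -> psdmx M -> M *m ones R n = ones R n ->
  (\sum_i x i) ^+ 2 <= n%:R * \sum_i \sum_j x i * M i j * x j.
Proof.
move=> n0 /psdmxP[Msym Mge0] /mul_onesP Me.
have nn0 : 0 < n%:R :> R by rewrite ltr0n.
set S := \sum_i x i; set q := \sum_i _.
have := Mge0 (fun i => x i - S / n%:R); rewrite quad_shift // -/S -/q.
rewrite -(pmulr_rge0 _ nn0) -[_ <= _ * q]subr_ge0.
suff -> : n%:R * (q - 2 * (S / n%:R) * S + (S / n%:R) ^+ 2 * n%:R) =
    n%:R * q - S ^+ 2 by [].
by field; exact: lt0r_neq0.
Qed.

(** [sum_sqr_le_psd] at the indicator vector of [K]. For a singleton it
    says that the diagonal entries are at least 1 / n. *)
Lemma card_sqr_le_diag (R : realType) n (M : 'M[R]_n) (K : {set 'I_n}) :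
  (0 < n)%N -> psdmx M -> M *m ones R n = ones R n ->
  {in K &, forall i j, i != j -> M i j = 0} ->
  #|K|%:R ^+ 2 <= n%:R * \sum_(i in K) M i i.
Proof.
move=> n0 psdM Me MK; have := sum_sqr_le_psd (fun i => (i \in K)%:R) n0 psdM Me.
rewrite (_ : \sum_i _ = #|K|%:R :> R); last first.
  rewrite -sum1_card natr_sum [RHS]big_mkcond.
  by apply: eq_bigr => i _; case: ifP.
suff -> : \sum_i \sum_j (i \in K)%:R * M i j * (j \in K)%:R =
    \sum_(i in K) M i i by [].
rewrite [RHS]big_mkcond; apply: eq_bigr => i _; case: ifP => iK; last first.
  by rewrite big1 // => j _; rewrite mul0r mul0r.
rewrite (bigD1 i) //= iK mul1r mulr1 big1 ?addr0 // => j ji.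
case: (boolP (j \in K)) => jK; last by rewrite mulr0.
by rewrite MK ?mulr0 ?mul0r // eq_sym.
Qed.

Lemma theta_hat_tr_gt0 (R : realType) n (G : sgraph 'I_n) (M : 'M[R]_n) :
  (0 < n)%N -> theta_hat_feasible G M -> 0 < \tr M.
Proof.
move=> n0 [psdM Me _ _].
have Mii i : 0 < M i i.
  rewrite -(pmulr_rgt0 _ (_ : 0 < n%:R)) ?ltr0n //.
  have := @card_sqr_le_diag _ _ _ [set i] n0 psdM Me.
  rewrite cards1 big_set1 expr1n => H; apply: lt_le_trans ltr01 (H _).
  by move=> j k /set1P-> /set1P->; rewrite eqxx.
rewrite /mxtrace (bigD1 (Ordinal n0)) //= ltr_pwDl //.
by apply: sumr_ge0 => i _; exact: ltW.
Qed.

Lemma theta_plus_le_hat (R : realType) n (G : sgraph 'I_n) :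
  (0 < n)%N -> vertex_transitive G -> theta_plus R G <= theta_hat R G.
Proof.
move=> n0 tG; have [[M MG ->] _] := theta_hat_min R G.
apply: (theta_plus_min R G).2.
have t0 := theta_hat_tr_gt0 n0 MG; have [psdA Ae AA A0] :=
  theta_hat_aut_mean n0 tG MG.
have nt0 : 0 <= n%:R / \tr M by rewrite divr_ge0 ?ler0n // ltW.
have tN0 := lt0r_neq0 t0.
exists ((n%:R / \tr M) *: aut_mean G M); split.
- split; first by rewrite tr_block_mx tr_scalar_mx trmxK linearZ /= psdA.1.
  move=> z; rewrite -[z]vsubmxK ones_quad.
  move: (usubmx z) (dsubmx z) => a x.
  have := sum_sqr_le_psd (fun i => x i 0) n0 psdA Ae.
  rewrite -scalemxAr -scalemxAl mxE -quadE.
  move: (_ 0 0) (\sum_i _) => q S; rewrite -subr_ge0 => Sq.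
  (* Completing the square, which is the Schur complement of the corner t. *)
  rewrite -(pmulr_rge0 _ t0).
  rewrite [X in 0 <= X](_ : _ = (\tr M * a 0 0 + S) ^+ 2 + (n%:R * q - S ^+ 2)).
    by apply: addr_ge0 Sq; exact: sqr_ge0.
  by field.
- by move=> i; rewrite mxE mulrAC aut_mean_diag // divff.
- by rewrite /mxdot linearZ /= -scalemxAl linearZ /= -/(mxdot _ _) AA mulr0.
- by move=> i j; rewrite mxE mulr_ge0.
Qed.

(** Among the vectors (b, e), the bordered matrix gives a quadratic in b whose
    positivity is equivalent to this bound; b = - T / n, with T the sum of the
    entries, already suffices. *)
Lemma theta_plus_feasible_total (R : realType) n (G : sgraph 'I_n) (x0 : R)
    (X : 'M[R]_n) : (0 < n)%N -> theta_plus_feasible G x0 X ->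
  n%:R ^+ 2 <= x0 * \sum_i \sum_j X i j.
Proof.
move=> n0 [[_ psdX] dX _ X0].
set T := \sum_i _; have nn0 : 0 < n%:R :> R by rewrite ltr0n.
(* The unit diagonal alone contributes n to T. *)
have T0 : 0 < T.
  apply: lt_le_trans nn0 _; rewrite -[n in n%:R]card_ord -sumr_const.
  apply: ler_sum => i _; rewrite (bigD1 i) //= dX lerDl.
  by apply: sumr_ge0.
have := psdX (col_mx (- (T / n%:R))%:M (ones R n)); rewrite ones_quad quadE.
rewrite (_ : \sum_i \sum_j _ = T); last first.
  by do 2![apply: eq_bigr => ? _]; rewrite !mxE mul1r mulr1.
under eq_bigr do rewrite mxE.
rewrite sumr_const card_ord mxE eqxx mulr1n.
rewrite -(pmulr_rge0 _ (_ : 0 < n%:R ^+ 2 / T)) ?divr_gt0 ?exprn_gt0 //.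
rewrite -[_ <= x0 * T]subr_ge0.
suff -> : n%:R ^+ 2 / T * (x0 * (- (T / n%:R)) ^+ 2 +
    2 * (- (T / n%:R)) * n%:R + T) = x0 * T - n%:R ^+ 2 by [].
by field; rewrite !lt0r_neq0.
Qed.

Lemma theta_hat_le_plus (R : realType) n (G : sgraph 'I_n) :
  (0 < n)%N -> vertex_transitive G -> theta_hat R G <= theta_plus R G.
Proof.
move=> n0 tG; have [[X XG] _] := theta_plus_min R G.
have nn0 : 0 < n%:R :> R by rewrite ltr0n.
have := theta_plus_feasible_total n0 XG; set T := \sum_i _ => nT.
have [psdX dX XA X0] := XG.
have XX : psdmx X.
  split.
    have := psdX.1; rewrite tr_block_mx => /(congr1 drsubmx).
    by rewrite !block_mxKdr.
  move=> x; have := psdX.2 (col_mx 0 x).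
  by rewrite ones_quad mxE expr0n /= !mulr0 mul0r !add0r.
have T0 : 0 < T.
  have : 0 <= T by apply: sumr_ge0 => i _; apply: sumr_ge0.
  rewrite le_eqVlt => /orP[/eqP T0|//].
  by move: nT; rewrite -T0 mulr0 leNgt exprn_gt0.
apply: (@le_trans _ _ (\tr ((n%:R / T) *: aut_mean G X))); last first.
  rewrite linearZ /= aut_mean_tr /mxtrace; under eq_bigr do rewrite dX.
  by rewrite sumr_const card_ord mulrAC -expr2 ler_pdivrMr.
apply: (theta_hat_min R G).2; exists ((n%:R / T) *: aut_mean G X) => //; split.
- by apply: psdmxZ (aut_mean_psd G XX); rewrite divr_ge0 ?ltW.
- apply/mul_onesP => i; under eq_bigr do rewrite mxE.
  by rewrite -mulr_sumr mulrAC aut_mean_row // divff // lt0r_neq0.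
- by rewrite /mxdot linearZ /= -scalemxAl linearZ /= -/(mxdot _ _)
     aut_mean_dot XA mulr0.
- by move=> i j; rewrite mxE mulr_ge0 ?divr_ge0 ?(ltW nn0) ?(ltW T0) //;
     exact: aut_mean_ge0.
Qed.

Lemma theta_plus_eq_hat (R : realType) n (G : sgraph 'I_n) :
  (0 < n)%N -> vertex_transitive G -> theta_plus R G = theta_hat R G.
Proof.
move=> n0 tG; apply/le_anti.
by rewrite theta_plus_le_hat ?theta_hat_le_plus.
Qed.

(** * The sandwich between clique and chromatic number *)

Lemma mxdot_adj_eq0 (R : realType) n (H : sgraph 'I_n) (M : 'M[R]_n) i j :
  nonneg_mx M -> mxdot M (adjmx R H) = 0 -> H i j -> M i j = 0.
Proof.
move=> M0; rewrite mxdot_sum => /eqP MH Hij.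
have W0 k l : 0 <= M k l * adjmx R H k l by rewrite mxE mulr_ge0 ?ler0n.
move: MH; rewrite psumr_eq0 => [|k _]; last exact: sumr_ge0.
move=> /allP /(_ i (mem_index_enum _)).
rewrite psumr_eq0 // => /allP /(_ j (mem_index_enum _)).
by rewrite mxE Hij mulr1 => /eqP.
Qed.

Lemma complK n (G : sgraph 'I_n) i j : compl (compl G) i j = G i j.
Proof.
have [->|ij] := eqVneq i j; first by rewrite !adjacent_irr.
by rewrite /= /compl_rel /= /compl_rel /= ij negbK.
Qed.

Lemma cliqueP (T : finType) (G : sgraph T) (K : {set T}) :
  reflect {in K &, forall x y, x != y -> G x y} (clique G K).
Proof.
apply: (iffP forall_inP) => [KG x y xK yK xy|KG x xK].
  by have /forall_inP/(_ y yK)/implyP := KG x xK; apply.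
by apply/forall_inP => y yK; apply/implyP; exact: KG.
Qed.

(** Off-diagonal entries indexed by [K] vanish, as they sit on edges of [G], the
    complement of [compl G]. By transitivity the diagonal sum over [K] is
    |K| / n times the trace, and one factor |K| cancels. *)
Lemma clique_le_theta_hat (R : realType) n (G : sgraph 'I_n) (K : {set 'I_n}) :
  (0 < n)%N -> vertex_transitive G -> clique G K ->
  #|K|%:R <= theta_hat R (compl G).
Proof.
move=> n0; rewrite -vertex_transitive_compl => tG /cliqueP KG.
have [[M MG ->] _] := theta_hat_min R (compl G).
have [->|K0] := posnP #|K|; first exact: ltW (theta_hat_tr_gt0 n0 MG).
have [psdA Ae AA A0] := theta_hat_aut_mean n0 tG MG.
have := @card_sqr_le_diag _ _ _ K n0 psdA Ae.
rewrite mulr_sumr; under eq_bigr do rewrite aut_mean_diag //.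
rewrite sumr_const -[\tr M *+ _]mulr_natl expr2 ler_pM2l ?ltr0n //; apply.
move=> i j iK jK ij; apply: mxdot_adj_eq0 A0 AA _.
by rewrite complK KG.
Qed.

Lemma omega_le_theta_hat (R : realType) n (G : sgraph 'I_n) :
  (0 < n)%N -> vertex_transitive G -> (omega G)%:R <= theta_hat R (compl G).
Proof.
move=> n0 tG; rewrite /omega.
have cl0 : clique G set0 by apply/cliqueP => x y; rewrite inE.
rewrite (bigop.bigmax_eq_arg set0) //.
by case: arg_maxnP => // K KG _; exact: clique_le_theta_hat.
Qed.

Section ColorClasses.
Variables (R : realType) (n k : nat) (c : 'I_n -> 'I_k).

Definition color_card (a : 'I_k) : R := #|[set i | c i == a]|%:R.

(** The orthogonal projection on the vectors that are constant on every class
    of [c]. *)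
Definition color_mx : 'M[R]_n :=
  \matrix_(i, j) ((c i == c j)%:R / color_card (c i)).

Lemma color_card_neq0 i : color_card (c i) != 0.
Proof. by rewrite pnatr_eq0 -lt0n; apply/card_gt0P; exists i; rewrite inE. Qed.

Lemma sum_color_class (a : 'I_k) : \sum_(i | c i == a) 1 = color_card a.
Proof. by rewrite sumr_const; congr _%:R; apply: eq_card => i; rewrite inE. Qed.

Lemma color_mx_row i : \sum_j color_mx i j = 1.
Proof.
under eq_bigr do rewrite mxE.
rewrite -mulr_suml; suff -> : \sum_j (c i == c j)%:R = color_card (c i).
  by rewrite divff ?color_card_neq0.
rewrite -sum_color_class [RHS]big_mkcond; apply: eq_bigr => j _.
by rewrite eq_sym; case: eqP.
Qed.

Lemma color_mx_psd : psdmx color_mx.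
Proof.
apply/psdmxP; split=> [i j|x].
  by rewrite !mxE eq_sym; case: eqP => [->|_] //; rewrite !mul0r.
rewrite (_ : \sum_i _ =
    \sum_a (\sum_(i | c i == a) x i) ^+ 2 / color_card a).
  by apply: sumr_ge0 => a _; rewrite divr_ge0 ?sqr_ge0 ?ler0n.
rewrite (partition_big c xpredT) //=; apply: eq_bigr => a _.
rewrite expr2 -mulrA mulr_suml; apply: eq_bigr => i /eqP <-.
rewrite mulr_suml mulr_sumr [RHS]big_mkcond /=; apply: eq_bigr => j _.
rewrite mxE eq_sym; case: eqP => _; last by rewrite mul0r mulr0 mul0r.
by rewrite mul1r -mulrA [_^-1 * _]mulrC.
Qed.

(** Each nonempty class contributes 1; empty ones, when [c] is not onto,
    contribute 0, which is why this is only an inequality. *)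
Lemma color_mx_tr : \tr color_mx <= k%:R.
Proof.
rewrite /mxtrace (partition_big c xpredT) //=.
rewrite -[k in k%:R]card_ord -sumr_const; apply: ler_sum => a _.
under eq_bigr => i /eqP ci do rewrite mxE eqxx ci.
rewrite -mulr_suml sum_color_class.
by have [->|/divff->//] := eqVneq (color_card a) 0; rewrite mul0r ler01.
Qed.

End ColorClasses.

Lemma theta_hat_le_chi (R : realType) n (G : sgraph 'I_n) :
  theta_hat R (compl G) <= (chi G)%:R.
Proof.
rewrite /chi; case: ex_minnP => k /existsP[c /forallP cG] _.
have ccG i j : G i j -> c i != c j.
  by have /forallP/(_ j)/implyP := cG i.
apply: le_trans (color_mx_tr R c).
apply: (theta_hat_min R (compl G)).2; exists (color_mx R c) => //; split.
- exact: color_mx_psd.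
- by apply/mul_onesP; exact: color_mx_row.
- rewrite mxdot_sum big1 // => i _; rewrite big1 // => j _.
  rewrite ![_ i j]mxE complK; case: (boolP (G i j)) => [/ccG/negbTE->|_].
    by rewrite !mul0r.
  by rewrite mulr0.
- by move=> i j; rewrite mxE divr_ge0 ?ler0n.
Qed.

Lemma omega_induced (T : finType) (G : sgraph T) (S : {set T}) :
  (omega (induced G S) <= omega G)%N.
Proof.
apply/bigmax_leqP => K /cliqueP KG; rewrite -(card_imset _ val_inj).
apply: (leq_bigmax_cond (F := fun K : {set T} => #|K|)).
apply/cliqueP => _ _ /imsetP[x xK ->] /imsetP[y yK ->].
by rewrite (inj_eq val_inj); exact: KG.
Qed.

Lemma chi_le_inducedT (T : finType) (G : sgraph T) :
  (chi G <= chi (induced G [set: T]))%N.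
Proof.
rewrite {2}/chi; case: ex_minnP => k /existsP[c /forallP cG] _.
rewrite /chi; case: ex_minnP => m _; apply.
apply/existsP; exists [ffun x => c (exist _ x (in_setT x))].
apply/forallP => x; apply/forallP => y; rewrite !ffunE.
by have /forallP/(_ (exist _ y (in_setT y))) := cG (exist _ x (in_setT x)).
Qed.

Lemma perfect_chi_le_omega (T : finType) (G : sgraph T) :
  perfect G -> (chi G <= omega G)%N.
Proof.
move=> /(_ [set: T]) pG; apply: leq_trans (chi_le_inducedT G) _.
by rewrite -pG omega_induced.
Qed.

Unset Implicit Arguments.

Theorem theorem21 (R : realType) (n : nat) (n_ge1 : (1 <= n)%N)
    (G : sgraph 'I_n) (G_vtrans : vertex_transitive G) :
  theta_plus R G = theta_hat R G /\
  (perfect G ->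
     (omega G)%:R = theta_hat R (compl G) /\
     theta_hat R (compl G) = (chi G)%:R).
Proof.
split=> [|pG]; first exact: theta_plus_eq_hat.
have lo := omega_le_theta_hat R n_ge1 G_vtrans.
have hi := theta_hat_le_chi R G.
have co : (chi G)%:R <= (omega G)%:R :> R.
  by rewrite ler_nat perfect_chi_le_omega.
by split; apply/le_anti; rewrite ?lo ?hi ?(le_trans hi co) ?(le_trans co lo).
Qed.
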